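(* Consider the Ehrhard-Müller system $$\dot x=s(y-x),\quad \dot y=rx-xz-y+c,\quad \dot z=xy-z,$$ with real parameters $s,r,c$ and $(x,y,z)\in\mathbb{R}^3$. This system has the Darboux invariant (a) $(x^2-z)e^{t}$ if $s=1/2$; (b) $(y^2+z^2-cx)e^{2t}$ if $s=2$ and $r=0$; (c) $(y^2+z^2)e^{2t}$ if $r=c=0$; (d) $(y^2+z^2-rx^2)e^{2t}$ if $s=1$ and $c=0$.
   Context: A function of the form $J(x,y,z,t)=I(x,y,z)e^{\sigma t}$, with $\sigma\in\mathbb{R}$, is a Darboux invariant of the system if $\frac{d}{dt}J(x(t),y(t),z(t),t)=0$ along all solutions $(x(t),y(t),z(t))$ of the system. *)

(* Defs.v *)
(* Stdlib reals with Coquelicot. *)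
From Stdlib Require Import Reals.
From Coquelicot Require Import Coquelicot.
Open Scope R_scope.

(* (x, y, z) solves x' = P, y' = Q, z' = S on the open interval (a, b); the
   endpoints may be infinite, since solutions need not exist for all times. *)
Definition is_solution (P Q S : R -> R -> R -> R) (a b : Rbar)
    (x y z : R -> R) : Prop :=
  forall t : R, Rbar_lt a t -> Rbar_lt t b ->
    is_derive x t (P (x t) (y t) (z t)) /\
    is_derive y t (Q (x t) (y t) (z t)) /\
    is_derive z t (S (x t) (y t) (z t)).

Definition is_darboux_invariant (P Q S : R -> R -> R -> R)
    (J : R -> R -> R -> R -> R) : Prop :=
  (exists (I : R -> R -> R -> R) (sigma : R),
     forall x y z t : R, J x y z t = I x y z * exp (sigma * t)) /\
  (forall (a b : Rbar) (x y z : R -> R),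
     is_solution P Q S a b x y z ->
     forall t : R, Rbar_lt a t -> Rbar_lt t b ->
       is_derive (fun u : R => J (x u) (y u) (z u) u) t 0).

(* The Ehrhard-Müller system with parameters s, r, c. *)
Definition EM_x (s : R) (x y z : R) : R := s * (y - x).
Definition EM_y (r c : R) (x y z : R) : R := r * x - x * z - y + c.
Definition EM_z (x y z : R) : R := x * y - z.

Definition EM_darboux_invariant (s r c : R) (J : R -> R -> R -> R -> R) : Prop :=
  is_darboux_invariant (EM_x s) (EM_y r c) EM_z J.

(* Main.v *)
(* Along solutions the polynomial factor [f] of each invariant satisfies
   [f' = - sigma f], so that [f * exp (sigma t)] has derivative zero. *)

Require Import Defs.
From Stdlib Require Import Reals.
From Coquelicot Require Import Coquelicot.
Open Scope R_scope.

(** Along solutions the [x*y*z] terms cancel in [(y^2 + z^2)' = -2(y^2 + z^2) + 2rxy + 2cy]. The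
    remainder [2rxy + 2cy] vanishes for [r = c = 0]; otherwise the correction [-c x] (at [s = 2],
    [r = 0]) or [-r x^2] (at [s = 1], [c = 0]) absorbs it. At [s = 1/2], [(x^2)' = xy - x^2] and
    [z' = xy - z] give [(x^2 - z)' = -(x^2 - z)]. *)

Lemma is_derive_mult_exp_0 (f : R -> R) (sigma t : R) :
  is_derive f t (- sigma * f t) ->
  is_derive (fun u => f u * exp (sigma * u)) t 0.
Proof.
intros Hf.
auto_derive.
- now exists (- sigma * f t).
- rewrite (is_derive_unique (fun u : R => f u) _ _ Hf); ring.
Qed.

(** Reduces each case to a polynomial identity at a single time, free of the interval of
    existence. *)
Lemma EM_darboux_invariant_intro (s r c sigma : R) (I : R -> R -> R -> R)
    (J : R -> R -> R -> R -> R) :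
  (forall x y z t : R, J x y z t = I x y z * exp (sigma * t)) ->
  (forall (x y z : R -> R) (t : R),
     is_derive x t (EM_x s (x t) (y t) (z t)) ->
     is_derive y t (EM_y r c (x t) (y t) (z t)) ->
     is_derive z t (EM_z (x t) (y t) (z t)) ->
     is_derive (fun u => I (x u) (y u) (z u)) t
       (- sigma * I (x t) (y t) (z t))) ->
  EM_darboux_invariant s r c J.
Proof.
intros HJ HI; split.
- now exists I, sigma.
- intros a b x y z Hsol t Hat Htb.
  destruct (Hsol t Hat Htb) as [Hx [Hy Hz]].
  apply (is_derive_ext (fun u => I (x u) (y u) (z u) * exp (sigma * u))).
  + now intros u; rewrite HJ.
  + exact (is_derive_mult_exp_0 _ _ _ (HI x y z t Hx Hy Hz)).
Qed.

(* The eta-expansions match the form in which [auto_derive] leaves the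
   derivatives of unknown functions. *)
Ltac derive_along_solution :=
  intros x y z t Hx Hy Hz;
  auto_derive;
  [ repeat split; eexists; eassumption
  | rewrite ?(is_derive_unique (fun u : R => x u) _ _ Hx),
      ?(is_derive_unique (fun u : R => y u) _ _ Hy),
      ?(is_derive_unique (fun u : R => z u) _ _ Hz);
    unfold EM_x, EM_y, EM_z; field ].

Theorem proposition2 (s r c : R) :
  (s = 1 / 2 ->
     EM_darboux_invariant s r c
       (fun x y z t => (x ^ 2 - z) * exp t)) /\
  (s = 2 -> r = 0 ->
     EM_darboux_invariant s r c
       (fun x y z t => (y ^ 2 + z ^ 2 - c * x) * exp (2 * t))) /\
  (r = 0 -> c = 0 ->
     EM_darboux_invariant s r c
       (fun x y z t => (y ^ 2 + z ^ 2) * exp (2 * t))) /\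
  (s = 1 -> c = 0 ->
     EM_darboux_invariant s r c
       (fun x y z t => (y ^ 2 + z ^ 2 - r * x ^ 2) * exp (2 * t))).
Proof.
split; [ | split; [ | split]].
- intros ->.
  apply (EM_darboux_invariant_intro _ _ _ 1 (fun x y z => x ^ 2 - z)).
  (* Here [sigma = 1], so [exp t] must be matched with [exp (1 * t)]. *)
  + now intros x y z t; rewrite Rmult_1_l.
  + derive_along_solution.
- intros -> ->.
  apply (EM_darboux_invariant_intro _ _ _ 2 (fun x y z => y ^ 2 + z ^ 2 - c * x)).
  + reflexivity.
  + derive_along_solution.
- intros -> ->.
  apply (EM_darboux_invariant_intro _ _ _ 2 (fun x y z => y ^ 2 + z ^ 2)).
  + reflexivity.
  + derive_along_solution.
- intros -> ->.
  apply (EM_darboux_invariant_intro _ _ _ 2 (fun x y z => y ^ 2 + z ^ 2 - r * x ^ 2)).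
  + reflexivity.
  + derive_along_solution.
Qed.
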